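(* Suppose $f$ satisfies quadratic growth with maximal modulus $\mu^*\in(0,\infty)$, and let $0<\widehat\mu\le\mu^*$. Let $\rho>0$ and $\eta\ge 0$. If $(\bar x,\psi)$ is a $(\rho,\eta)$-regularized bundle certificate, then $$f(\bar x)-f^*\le \max\left\{2,\frac{4\rho}{\widehat\mu}\right\}\eta .$$
   Context: $X\subseteq\mathbb R^n$ is a nonempty closed convex set, $f:X\to\mathbb R$ is convex and lower semicontinuous and attains its minimum $f^*=\min_{x\in X}f(x)$; $X^*=\operatorname{argmin}_{x\in X}f(x)$. $\|\cdot\|$ is the Euclidean norm and $\operatorname{dist}(x,S)=\inf_{y\in S}\|x-y\|$. Quadratic growth (QG): the maximal QG modulus is $\mu^*:=\sup\{\nu>0:\ f(x)-f^*\ge\frac{\nu}{2}\operatorname{dist}^2(x,X^* )\ \text{for every }x\in X\}$; $f$ satisfies quadratic growth if $\mu^*>0$, and $0<\mu^*<\infty$ is assumed. Regularized bundle certificate (RBCer): let $\psi:X\to\mathbb R$ be a finite-valued, lower semicontinuous convex function with $\psi(x)\le f(x)$ for every $x\in X$, and let $\rho>0$. For $\bar x\in X$ put $\Delta_\rho(\bar x;\psi):=\max_{x\in X}\{f(\bar x)-\psi(x)-\frac{\rho}{2}\|x-\bar x\|^2\}$ (the maximum is attained). For $\eta\ge0$, $(\bar x,\psi)$ is a $(\rho,\eta)$-regularized bundle certificate, or $(\rho,\eta)$-RBCer, if $\Delta_\rho(\bar x;\psi)\le\eta$. *)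

(* Defs.v *)
From HB Require Import structures.
From mathcomp Require Import all_boot all_order all_algebra.
From mathcomp Require Import all_classical all_reals all_analysis.

Set Implicit Arguments.
Unset Strict Implicit.
Unset Printing Implicit Defensive.

Import Order.TTheory GRing.Theory Num.Theory.
Import numFieldNormedType.Exports.

Local Open Scope classical_set_scope.
Local Open Scope ring_scope.

(** A function X -> R is represented by a total function on 'rV[R]_n; all the
    definitions below, and the library's [convex_function X f], only depend on
    its values on X. *)

Section Defs.
Context {R : realType} {n : nat}.
Implicit Types (X S : set 'rV[R]_n) (f psi : 'rV[R]_n -> R) (x y : 'rV[R]_n).

(** The library norm on matrices is the sup norm, hence this definition. *)
Definition enorm x : R := Num.sqrt (\sum_(i < n) x ord0 i ^+ 2).

Definition dist x S : R := inf [set enorm (x - y) | y in S].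

(** Lower semicontinuity relative to X: in the topology of [subspace X], a point
    of X has its trace neighbourhoods and a point outside X is isolated. *)
Definition lsc_on X f : Prop :=
  lower_semicontinuous ((fun x => (f x)%:E) : subspace X -> \bar R).

Definition minval X f : R := inf [set f x | x in X].

Definition argmin X f : set 'rV[R]_n :=
  [set x | X x /\ forall y, X y -> f x <= f y].

(** Taken in [\bar R], so that it is +oo when the moduli are unbounded and -oo
    when there are none. *)
Definition qg_modulus X f : \bar R :=
  ereal_sup [set nu%:E | nu in [set nu : R | 0 < nu /\
    forall x, X x ->
      nu / 2 * dist x (argmin X f) ^+ 2 <= f x - minval X f]].

Definition quadratic_growth X f : Prop := (0 < qg_modulus X f)%E.

(** The maximum is written as a supremum in [\bar R], so that no attainment or
    boundedness has to be presupposed. *)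
Definition rb_gap X f (rho : R) (xbar : 'rV[R]_n) psi : \bar R :=
  ereal_sup [set (f xbar - psi x - rho / 2 * enorm (x - xbar) ^+ 2)%:E
            | x in X].

Definition lower_model X f psi : Prop :=
  [/\ convex_function X psi, lsc_on X psi & forall x, X x -> psi x <= f x].

Definition RBCer X f (rho eta : R) (xbar : 'rV[R]_n) psi : Prop :=
  [/\ X xbar, lower_model X f psi & (rb_gap X f rho xbar psi <= eta%:E)%E].

End Defs.

(* Main.v *)
Require Import Defs.
From HB Require Import structures.
From mathcomp Require Import all_boot all_order all_algebra.
From mathcomp Require Import all_classical all_reals all_analysis.
From mathcomp Require Import lra ring.
Import Order.TTheory GRing.Theory Num.Theory.
Import numFieldNormedType.Exports.
Local Open Scope classical_set_scope.
Local Open Scope ring_scope.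

(** Write D for the gap f xbar - f* and d for the distance from xbar to the set
    of minimizers.  The certificate bounds the decrease of psi away from xbar, up
    to a quadratic penalty.  Testing it at the points xbar + t (y - xbar) of the
    segment towards a minimizer y, where psi <= f and f lies below its chord,
    gives

      t D - rho / 2 * t ^ 2 * |xbar - y| ^ 2 <= eta    for 0 <= t <= 1

    ([RBCer_segment]).  Taking the infimum over y replaces |xbar - y| by d
    ([RBCer_dist]), and quadratic growth ([qg_modulus_growth]) bounds d ^ 2 by
    2 D / muhat, so that

      (t - rho / muhat * t ^ 2) D <= eta.

    The factor of D is largest at t = muhat / (2 rho), where it equals
    muhat / (4 rho).  When this t exceeds 1, the choice t = 1 is admissible and
    makes the factor 1 - rho / muhat >= 1 / 2.  These two cases are the two
    terms of the maximum. *)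

Lemma minval_argmin {R : realType} {n : nat} {X : set 'rV[R]_n}
    {f : 'rV[R]_n -> R} {y : 'rV[R]_n} :
  argmin X f y -> minval X f = f y.
Proof.
move=> [Xy ymin]; apply/eqP; rewrite eq_le; apply/andP; split.
  by apply: ge_inf; [exists (f y) => _ [z Xz <-]; exact: ymin|exists y].
by apply: lb_le_inf; [exists (f y), y|move=> _ [z Xz <-]; exact: ymin].
Qed.

Lemma enorm_sqrE {R : realType} {n : nat} (v : 'rV[R]_n) :
  enorm v ^+ 2 = \sum_(i < n) v ord0 i ^+ 2.
Proof. by rewrite sqr_sqrtr// sumr_ge0// => i _; exact: sqr_ge0. Qed.

Lemma enorm_sqrZ {R : realType} {n : nat} (t : R) (v : 'rV[R]_n) :
  enorm (t *: v) ^+ 2 = t ^+ 2 * enorm v ^+ 2.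
Proof.
by rewrite !enorm_sqrE mulr_sumr; apply: eq_bigr => i _; rewrite mxE exprMn.
Qed.

Lemma le_dist_sqr {R : realType} {n : nat} {S : set 'rV[R]_n}
    {x : 'rV[R]_n} {s : R} :
  S !=set0 -> (forall y, S y -> s <= enorm (x - y) ^+ 2) ->
  s <= dist x S ^+ 2.
Proof.
move=> [y0 Sy0] sle.
have [s0|/ltW s0] := leP s 0; first exact: le_trans s0 (sqr_ge0 _).
have sqrt_le : Num.sqrt s <= dist x S.
  apply: lb_le_inf; first by exists (enorm (x - y0)), y0.
  move=> _ [y Sy <-]; rewrite -(ger0_norm (sqrtr_ge0 _ : 0 <= enorm (x - y))).
  by rewrite -sqrtr_sqr ler_wsqrtr// sle.
rewrite -(sqr_sqrtr s0) ler_sqr// nnegrE ?sqrtr_ge0//.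
exact: le_trans (sqrtr_ge0 s) sqrt_le.
Qed.

(** The growth inequality is closed in the modulus, so it passes from the
    admissible moduli to everything below their supremum, the supremum
    included. *)
Lemma qg_modulus_growth {R : realType} {n : nat} {X : set 'rV[R]_n}
    {f : 'rV[R]_n -> R} {mu : R} {x : 'rV[R]_n} :
  argmin X f !=set0 -> (mu%:E <= qg_modulus X f)%E -> X x ->
  mu / 2 * dist x (argmin X f) ^+ 2 <= f x - minval X f.
Proof.
move=> [y ymin] mu_le Xx.
have gap_ge0 : 0 <= f x - minval X f.
  by rewrite (minval_argmin ymin) subr_ge0; exact: (proj2 ymin).
have := sqr_ge0 (dist x (argmin X f)).
set d2 := dist x (argmin X f) ^+ 2; rewrite le_eqVlt => /orP[/eqP <-|d2_gt0].
  by rewrite mulr0.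
suff : mu <= 2 * (f x - minval X f) / d2 by rewrite ler_pdivlMr// => ?; lra.
rewrite -lee_fin; apply: (le_trans mu_le).
apply: ge_ereal_sup => _ [nu [_ growth] <-]; rewrite lee_fin ler_pdivlMr//.
have := growth x Xx; rewrite -/d2; lra.
Qed.

(** Along a segment issued from xbar, convexity makes the guaranteed decrease
    of f first order in t, while the penalty is second order. *)
Lemma RBCer_segment {R : realType} {n : nat} {X : set 'rV[R]_n}
    {f psi : 'rV[R]_n -> R} {rho eta : R} {xbar y : 'rV[R]_n} (t : R) :
  convex_set X -> convex_function X f -> RBCer X f rho eta xbar psi ->
  X y -> 0 <= t -> t <= 1 ->
  t * (f xbar - f y) - rho / 2 * (t ^+ 2 * enorm (xbar - y) ^+ 2) <= eta.
Proof.
move=> cvxX cvxf [Xxbar [_ _ psi_le] gap_le] Xy t_ge0 t_le1.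
pose t01 : {i01 R} := Itv01 t_ge0 t_le1.
pose z : 'rV[R]_n := conv t01 (y : convex_lmodType 'rV[R]_n) xbar.
have Xz : X z by apply/set_mem; apply: cvxX; exact/mem_set.
have fz : f z <= t * f y + (1 - t) * f xbar.
  by apply: (cvxf t01 y xbar); exact/mem_set.
have z_sub : z - xbar = (- t) *: (xbar - y).
  have -> : z = t *: y + (1 - t) *: xbar by [].
  rewrite scalerBl scale1r scaleNr scalerBr opprB addrCA.
  by rewrite -addrA addrC subrK addrC.
have : f xbar - psi z - rho / 2 * enorm (z - xbar) ^+ 2 <= eta.
  rewrite -lee_fin; apply: le_trans gap_le.
  by apply: ereal_sup_ubound; exists z.
rewrite z_sub enorm_sqrZ sqrrN.
have := psi_le z Xz; lra.
Qed.

(** [RBCer_segment] is solved for the squared distance to a minimizer, which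
    makes it a lower bound that passes to the infimum over the minimizers. *)
Lemma RBCer_dist {R : realType} {n : nat} {X : set 'rV[R]_n}
    {f psi : 'rV[R]_n -> R} {rho eta : R} {xbar : 'rV[R]_n} (t : R) :
  convex_set X -> convex_function X f -> argmin X f !=set0 ->
  RBCer X f rho eta xbar psi -> 0 < rho -> 0 < t -> t <= 1 ->
  t * (f xbar - minval X f)
    - rho / 2 * (t ^+ 2 * dist xbar (argmin X f) ^+ 2) <= eta.
Proof.
move=> cvxX cvxf nonempty cert rho_gt0 t_gt0 t_le1.
have c_gt0 : 0 < rho / 2 * t ^+ 2 by rewrite mulr_gt0 ?exprn_gt0//; lra.
rewrite mulrA lerBlDl -lerBlDr -ler_pdivrMl// mulrC.
apply: le_dist_sqr => // y ymin.
rewrite mulrC ler_pdivrMl// lerBlDr -lerBlDl (minval_argmin ymin).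
have := RBCer_segment t cvxX cvxf cert (proj1 ymin) (ltW t_gt0) t_le1; lra.
Qed.

Theorem proposition3p1 (R : realType) (n : nat)
    (X : set 'rV[R]_n) (f : 'rV[R]_n -> R)
    (X_nonempty : X !=set0) (X_closed : closed X) (X_convex : convex_set X)
    (f_convex : convex_function X f) (f_lsc : lsc_on X f)
    (f_attains_min : argmin X f !=set0)
    (f_qg : quadratic_growth X f) (qg_finite : (qg_modulus X f < +oo)%E)
    (muhat : R) (muhat_gt0 : 0 < muhat)
    (muhat_le : (muhat%:E <= qg_modulus X f)%E)
    (rho eta : R) (rho_gt0 : 0 < rho) (eta_ge0 : 0 <= eta)
    (xbar : 'rV[R]_n) (psi : 'rV[R]_n -> R)
    (cert : RBCer X f rho eta xbar psi) :
  f xbar - minval X f <= Num.max 2 (4 * rho / muhat) * eta.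
Proof.
have Xxbar : X xbar by case: cert.
have growth := qg_modulus_growth f_attains_min muhat_le Xxbar.
have test t := RBCer_dist t X_convex f_convex f_attains_min cert rho_gt0.
move: growth test; set D := f xbar - _; set d2 := dist _ _ ^+ 2 => growth test.
rewrite maxr_pMl// le_max; apply/orP.
have [rho_small|rho_large] := leP (2 * rho) muhat.
- left; have d2_ge0 : 0 <= d2 := sqr_ge0 _.
  have := test 1 ltr01 (lexx 1).
  have : rho * d2 <= muhat / 2 * d2 by rewrite ler_wpM2r//; lra.
  lra.
- right.
  pose t := muhat / (2 * rho).
  have t_gt0 : 0 < t by rewrite divr_gt0//; lra.
  have t_le1 : t <= 1 by rewrite ler_pdivrMr; lra.
  have rho_t : rho * t = muhat / 2.
    by rewrite /t; field; rewrite gt_eqF.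
  have -> : 4 * rho / muhat = 2 / t.
    by rewrite /t; field; rewrite !gt_eqF.
  rewrite mulrAC ler_pdivlMr//.
  (* With this t, quadratic growth bounds the penalty by half of the
     first-order term t * D. *)
  have penaltyE : rho / 2 * (t ^+ 2 * d2) = t / 2 * (muhat / 2 * d2).
    by rewrite -rho_t; ring.
  have := test t t_gt0 t_le1; rewrite penaltyE.
  have := ler_wpM2l (ltW t_gt0) growth; lra.
Qed.
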